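(* Let $0<\alpha<1$. There exist a function $f\in\Lambda_{\alpha}(\mathbb{R})$ and a constant $c=c(f)>0$ such that for any $0<\varepsilon<1/2$ one has $$\int_{\varepsilon}^{1}\frac{|f(x+h)-f(x-h)|}{h^{\alpha}}\,\frac{dh}{h}>c\log(1/\varepsilon)$$ at almost every $x\in\mathbb{R}$ (with respect to Lebesgue measure).
   Context: For $0<\alpha<1$, $\Lambda_{\alpha}(\mathbb{R})$ is the class of functions $f\colon\mathbb{R}\to\mathbb{R}$ for which there exists a constant $C>0$ with $|f(x)-f(y)|\le C|x-y|^{\alpha}$ for all $x,y\in\mathbb{R}$. *)

(* Defs.v *)
From HB Require Import structures.
From mathcomp Require Import all_boot all_order all_algebra.
From mathcomp Require Import all_classical all_reals all_analysis.
Import Order.TTheory GRing.Theory Num.Theory.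
Import numFieldNormedType.Exports.

Set Implicit Arguments.
Unset Strict Implicit.
Unset Printing Implicit Defensive.

Local Open Scope classical_set_scope.
Local Open Scope ring_scope.

(* The class Lambda_alpha(R), meant for 0 < alpha < 1; for such alpha,
   0 `^ alpha = 0, so the case x = y of the bound is harmless. No bound on
   f itself is required: the condition is on increments only. *)
Definition Lambda (R : realType) (alpha : R) : set (R -> R) :=
  [set f | exists C : R, 0 < C /\
    forall x y : R, `|f x - f y| <= C * `|x - y| `^ alpha].

(* Main.v *)
Require Import Defs.
From HB Require Import structures.
From mathcomp Require Import all_boot all_order all_algebra.
From mathcomp Require Import all_classical all_reals all_analysis.
From mathcomp Require Import ring lra.
Import Order.TTheory GRing.Theory Num.Theory.
Import numFieldNormedType.Exports.

Set Implicit Arguments.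
Unset Strict Implicit.
Unset Printing Implicit Defensive.

Local Open Scope classical_set_scope.
Local Open Scope ring_scope.

(** The function is a lacunary series $f(x) = \sum_k b^{-k\alpha} S(b^k x)$
built on the two-frequency profile $S(z) = \sin 4\pi z + \sin 8\pi z$, with
$b$ a large multiple of 8. It is Hoelder by the usual splitting of the series
at the scale of the increment, and the integral bound holds at every $x$, not
only almost everywhere.

Two harmonics are used because the symmetric difference of $S$ at $y$ has
amplitudes $2\cos 4\pi y$ and $2\cos 8\pi y$: a single sine has a
symmetric difference that vanishes identically at its points of symmetry,
whereas by the duplication formula these two cosines are never both small.
Hence for every $y$ two of the steps $5/8, 7/8, 9/16, 11/16$ give symmetric
differences of $S$ at $y$ at distance at least 2
([profile_separation]), and the paired steps differ by a multiple of $1/8$.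

Fix $x$ and a scale $b^{-n}$, and compare the symmetric differences of $f$ at
the two steps above scaled by $b^{-n}$, with $y = b^n x$. The terms $k > n$
cancel exactly, because $b/8$ is an integer and $S$ has period 1. The term
$k = n$ contributes at least $2 b^{-n\alpha}$. The terms $k < n$ contribute
at most $b^{-n\alpha}$, because $S$ is Lipschitz and $b^{1-\alpha}$ is
large. So at one of the two steps the symmetric difference is at least
$b^{-n\alpha}/2$ ([symdiff_large_at_scale]). By Hoelder continuity it stays
above $b^{-n\alpha}/4$ on an interval of length $\delta b^{-n}$
([kernel_bump]), which contributes at least $\delta/4$ to the integral.
These intervals are disjoint for different $n$, and about
$\log_b(1/\varepsilon)$ of them lie in $[\varepsilon, 1]$
([multiscale_integral_ge]). As they lie in $[b^{-n}/2, b^{-n}]$, the one with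
$n = 0$ is always counted when $\varepsilon < 1/2$, so the bound does not
degenerate for $\varepsilon$ near $1/2$. *)

(** * The two-frequency profile *)

Lemma sin_lipschitz (R : realType) (x y : R) : `|sin x - sin y| <= `|x - y|.
Proof.
wlog xy : x y / y <= x.
  by move=> H; have [/H//|/ltW/H] := leP y x; rewrite distrC (distrC y).
have cs : {within `[y, x], continuous (@sin R)}.
  by apply: continuous_subspaceT => z; exact: continuous_sin.
have [c _ ->] := MVT_segment xy (fun z _ => is_derive_sin z) cs.
by rewrite normrM ler_piMl// cos_max.
Qed.

Definition profile (R : realType) (z : R) : R :=
  sin (4 * pi * z) + sin (8 * pi * z).

Lemma profile_le2 (R : realType) (z : R) : `|profile z| <= 2.
Proof.
by rewrite (le_trans (ler_normD _ _))// (_ : 2 = 1 + 1)// lerD// sin_max.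
Qed.

Lemma profile_lipschitz (R : realType) (x y : R) :
  `|profile x - profile y| <= 12 * pi * `|x - y|.
Proof.
have -> : profile x - profile y =
  (sin (4 * pi * x) - sin (4 * pi * y)) + (sin (8 * pi * x) - sin (8 * pi * y)).
  by rewrite /profile; ring.
rewrite (le_trans (ler_normD _ _))//.
have -> : 12 * pi * `|x - y| = `|4 * pi * x - 4 * pi * y| + `|8 * pi * x - 8 * pi * y|.
  rewrite -!mulrBr !normrM (ger0_norm (pi_ge0 R)) !normr_nat; ring.
by rewrite lerD// sin_lipschitz.
Qed.

Lemma profileD1 (R : realType) (z : R) : profile (z + 1) = profile z.
Proof.
rewrite /profile.
have -> : 4 * pi * (z + 1) = 4 * pi * z + (pi *+ 2) *+ 2 by ring.
have -> : 8 * pi * (z + 1) = 8 * pi * z + (pi *+ 2) *+ 4 by ring.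
by rewrite !(periodicn (@sinD2pi R)).
Qed.

Definition symdiff (R : realType) (f : R -> R) (x h : R) : R :=
  f (x + h) - f (x - h).

Lemma sinDB (R : realType) (a b : R) : sin (a + b) - sin (a - b) = 2 * cos a * sin b.
Proof. by rewrite sinD sinB; ring. Qed.

Lemma symdiff_profile (R : realType) (y u : R) :
  symdiff (@profile R) y u = 2 * cos (4 * pi * y) * sin (4 * pi * u)
                      + 2 * cos (8 * pi * y) * sin (8 * pi * u).
Proof. by rewrite /symdiff/profile -!sinDB !mulrBr !mulrDr; ring. Qed.

(** The steps 5/8 and 7/8 are zeros of the second harmonic where the first one
takes the values 1 and -1, so they isolate the amplitude $\cos 4\pi y$. At
9/16 and 11/16 the first harmonic takes equal values and the second one the
values 1 and -1, which isolates $\cos 8\pi y = 2\cos^2 4\pi y - 1$.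
The conclusion that $8(v-u)$ is an integer lets the higher terms of a lacunary
series cancel between the two steps. *)
Lemma profile_separation (R : realType) (y : R) :
  exists u v : R, [/\ 9 / 16 <= u, u <= v, v <= 7 / 8,
    exists j : nat, 8 * (v - u) = j%:R &
    2 <= `|symdiff (@profile R) y v - symdiff (@profile R) y u|].
Proof.
have spi2 : sin (pi / 2) = 1 :> R := sin_pihalf R.
have c8 : cos (8 * pi * y) = 2 * cos (4 * pi * y) ^+ 2 - 1.
  have -> : 8 * pi * y = (4 * pi * y) *+ 2 by ring.
  by rewrite cos_mulr2n -mulr_natr mulrC.
have [ca|ca] := leP (1 / 2) `|cos (4 * pi * y)|.
  exists (5 / 8), (7 / 8); split; try lra.
    by exists 2%N; field.
  rewrite !symdiff_profile.
  have -> : 4 * pi * (5 / 8) = pi / 2 + pi *+ 2 :> R by field.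
  have -> : 4 * pi * (7 / 8) = pi / 2 + pi *+ 3 :> R by field.
  have -> : 8 * pi * (5 / 8) = 0 + pi *+ 5 :> R by field.
  have -> : 8 * pi * (7 / 8) = 0 + pi *+ 7 :> R by field.
  rewrite !(alternatingn (@sinDpi R)) sin0 spi2.
  set c := cos _ in ca *; set c' := cos (8 * _ * _).
  rewrite (_ : _ - _ = (-4) * c); last by ring.
  by rewrite normrM normrN normr_nat; lra.
exists (9 / 16), (11 / 16); split; try lra.
  by exists 1%N; field.
rewrite !symdiff_profile.
have -> : 4 * pi * (11 / 16) = - (4 * pi * (9 / 16)) + pi *+ 5 :> R by field.
have -> : 8 * pi * (9 / 16) = pi / 2 + pi *+ 4 :> R by field.
have -> : 8 * pi * (11 / 16) = pi / 2 + pi *+ 5 :> R by field.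
rewrite !(alternatingn (@sinDpi R)) spi2 c8 sinN.
set c := cos _ in ca *; set s := sin _.
rewrite (_ : _ - _ = 4 * (1 - 2 * c ^+ 2)); last by ring.
have : c ^+ 2 <= 1 / 4.
  rewrite -real_normK ?num_real//.
  have := normr_ge0 c; nra.
move=> ?; rewrite ger0_norm; lra.
Qed.

(** * Lacunary series *)

Section lacunary.
Variables (R : realType) (S : R -> R) (q B M : R).

Definition lacunary (x : R) : R :=
  limn (series (fun k => q ^+ k * S (B ^+ k * x))).

Hypotheses (q0 : 0 < q) (q1 : q < 1) (SM : forall z, `|S z| <= M).

Let M0 : 0 <= M. Proof. exact: le_trans (SM 0). Qed.

Let term_le x k : `|q ^+ k * S (B ^+ k * x)| <= geometric M q k.
Proof.
rewrite /= normrM ger0_norm ?exprn_ge0 ?(ltW q0)//.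
by rewrite mulrC ler_wpM2r ?exprn_ge0 ?(ltW q0)//.
Qed.

Let qnorm : `|q| < 1. Proof. by rewrite ger0_norm// ltW. Qed.

Let cvg_normed x : cvgn [normed series (fun k => q ^+ k * S (B ^+ k * x))].
Proof.
apply: (series_le_cvg _ _ (term_le x)) => [//|k|].
  by rewrite geometric_ge0// ltW.
exact: is_cvg_geometric_series.
Qed.

Let cvg_lacunary x : cvgn (series (fun k => q ^+ k * S (B ^+ k * x))).
Proof. by apply: normed_cvg; exact: cvg_normed. Qed.

Lemma lacunary_le x : `|lacunary x| <= M / (1 - q).
Proof.
have cn : cvgn [normed series (fun k => q ^+ k * S (B ^+ k * x))].
  exact: cvg_normed.
apply: (le_trans (@lim_series_norm _ R^o _ cn)).
rewrite -(cvg_lim _ (cvg_geometric_series (a := M) qnorm))//.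
apply: lim_series_le => //; [exact: is_cvg_geometric_series|exact: term_le].
Qed.

(** Self-similarity: removing the first term and rescaling by $B$ gives back
the series. *)
Lemma lacunaryE x : lacunary x = S x + q * lacunary (B * x).
Proof.
rewrite /lacunary; apply: cvg_lim => //; rewrite -cvg_shiftS.
have -> : [sequence (series (fun k => q ^+ k * S (B ^+ k * x)) n.+1 : R)]_n =
  (fun n => S x + q * series (fun k => q ^+ k * S (B ^+ k * (B * x))) n).
  apply/funext => n; rewrite /= !seriesEord/= big_ord_recl/= !expr0 !mul1r.
  congr (_ + _); rewrite mulr_sumr; apply: eq_bigr => i _.
  by rewrite /bump/= add1n !exprSr -!mulrA mulrCA.
apply: cvgD; first exact: cvg_cst.
by apply: cvgM; [exact: cvg_cst|exact: cvg_lacunary].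
Qed.

Lemma lacunary_expand n x :
  lacunary x = \sum_(k < n) q ^+ k * S (B ^+ k * x) + q ^+ n * lacunary (B ^+ n * x).
Proof.
elim: n => [|n IH]; first by rewrite big_ord0 !expr0 !mul1r add0r.
rewrite IH big_ord_recr/= -addrA; congr (_ + _).
by rewrite lacunaryE mulrDr !exprSr !mulrA (mulrC B).
Qed.

End lacunary.

Lemma lacunaryD1 (R : realType) (S : R -> R) (q : R) (b : nat) (x : R) :
  (forall z, S (z + 1) = S z) -> lacunary S q b%:R (x + 1) = lacunary S q b%:R x.
Proof.
move=> SD1; rewrite /lacunary; congr (limn (series _)); apply/funext => k.
by rewrite mulrDr mulr1 -natrX (periodicn SD1).
Qed.

(** * Increments of a lacunary series *)

Lemma bracket_scale (R : realType) (b : nat) (d : R) : (1 < b)%N ->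
  0 < d -> d < 1 -> exists n : nat, b%:R ^- n.+1 <= d < b%:R ^- n.
Proof.
move=> b1 d0 d1.
have ex : exists n : nat, (b%:R : R) ^- n <= d.
  exists (Num.truncn d^-1).+1.
  rewrite invf_ple ?posrE ?exprn_gt0 ?ltr0n ?(ltnW b1)//.
  rewrite (le_trans (ltW (truncnS_gt _)))// -natrX ler_nat ltnW// ltn_expl//.
case: (ex_minnP ex) => -[|n] nd nmin.
  by move: nd; rewrite expr0 invr1 leNgt d1.
exists n; rewrite nd/= ltNge; apply/negP => /nmin.
by rewrite ltnn.
Qed.

Lemma sum_geometric_le (R : realType) (r : R) (n : nat) : 1 < r ->
  \sum_(k < n) r ^+ k <= r ^+ n / (r - 1).
Proof.
move=> r1; rewrite ler_pdivlMr ?subr_gt0// mulrC -subrX1 lerBlDr lerDl//.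
Qed.

Lemma powR_scale (R : realType) (B a : R) (n : nat) : 0 <= B ->
  (B ^- n) `^ a = (B `^ (- a)) ^+ n.
Proof.
move=> B0; rewrite -exprVn; elim: n => [|n IH]; first by rewrite !expr0 powR1.
rewrite !exprS powRM ?exprn_ge0 ?invr_ge0// IH; congr (_ * _).
by rewrite -powR_inv1// -powRrM mulN1r.
Qed.

Section increments.
Variables (R : realType) (S : R -> R) (q : R) (b : nat) (L M : R).
Hypotheses (q0 : 0 < q) (q1 : q < 1) (qb : 1 < q * b%:R).
Hypotheses (SM : forall z, `|S z| <= M)
  (SL : forall y z, `|S y - S z| <= L * `|y - z|).

Local Notation B := (b%:R : R).
Local Notation f := (lacunary S q B).

Let L0 : 0 <= L.
Proof. by have := SL 1 0; rewrite subr0 normr1 mulr1; exact: le_trans. Qed.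

Let B1 : 1 < B.
Proof.
rewrite ltNge; apply/negP => B1; move: qb; apply/negP; rewrite -leNgt.
by rewrite mulr_ile1 ?(ltW q0) ?(ltW q1).
Qed.

(** Since $qB > 1$, the Lipschitz constants $q^k L B^k$ of the terms grow
geometrically, so the last one dominates their sum. *)
Lemma partial_sum_increment_le (n : nat) (x y : R) :
  `|\sum_(k < n) q ^+ k * S (B ^+ k * x) - \sum_(k < n) q ^+ k * S (B ^+ k * y)|
  <= L / (q * B - 1) * (q ^+ n * (B ^+ n * `|x - y|)).
Proof.
rewrite -sumrB (le_trans (ler_norm_sum _ _ _))//.
apply: (@le_trans _ _ (L * `|x - y| * \sum_(k < n) (q * B) ^+ k)).
  rewrite mulr_sumr; apply: ler_sum => k _.
  rewrite -mulrBr normrM ger0_norm ?exprn_ge0 ?(ltW q0)//.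
  rewrite exprMn mulrCA ler_wpM2l ?exprn_ge0 ?(ltW q0)//.
  rewrite (le_trans (SL _ _))// -mulrBr normrM ger0_norm ?exprn_ge0//.
  by rewrite -mulrA (mulrC `|_|).
rewrite (le_trans (ler_wpM2l _ (sum_geometric_le n qb))) ?mulr_ge0//.
rewrite exprMn le_eqVlt; apply/orP; left; apply/eqP; ring.
Qed.

(** For $B^{-n-1} \le d < B^{-n}$, with $d$ the distance of the two points,
the terms of index at most $n$ are estimated by their Lipschitz constants and
the remaining ones by their size; both bounds are of order
$q^{n+1} = B^{-(n+1)\alpha} \le d^\alpha$. Distances at least 1 need only
that the series is bounded. *)
Lemma lacunary_Lambda (alpha : R) : q = B `^ (- alpha) -> 0 < alpha ->
  Lambda alpha f.
Proof.
move=> qE alpha0.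
have K0 : 0 <= M / (1 - q) by apply: le_trans (lacunary_le B q0 q1 SM 0).
have b1 : (1 < b)%N.
  by rewrite -(ltr_nat R).
have c0 : 0 <= L / (q * B - 1) by rewrite divr_ge0// subr_ge0 ltW.
exists (L / (q * B - 1) * B + 2 * (M / (1 - q)) + 1); split.
  by rewrite ltr_wpDl// addr_ge0// mulr_ge0.
move=> x y.
have fK z : `|f z| <= M / (1 - q) := lacunary_le B q0 q1 SM z.
have osc u v : `|f u - f v| <= 2 * (M / (1 - q)).
  by rewrite (le_trans (ler_normB _ _))// mulrDl mul1r lerD.
set d := `|x - y|.
have [d1|d1] := leP 1 d.
  have dpow : 1 <= d `^ alpha.
    apply: (@le_trans _ _ (1 `^ alpha)); first by rewrite powR1.
    by rewrite ge0_ler_powR ?nnegrE// ?(ltW alpha0)// (le_trans _ d1).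
  rewrite (le_trans (osc _ _))// -[leLHS]mulr1; apply: ler_pM => //.
    by rewrite mulr_ge0.
  by rewrite -addrA addrCA lerDl addr_ge0// mulr_ge0.
have := normr_ge0 (x - y); rewrite -/d le_eqVlt => /orP[/eqP d0|d0].
  have -> : x = y by apply/eqP; rewrite -subr_eq0 -normr_eq0 -/d -d0.
  by rewrite subrr normr0 mulr_ge0 ?powR_ge0// !addr_ge0// mulr_ge0.
have [n /andP[nd dn]] := bracket_scale b1 d0 d1.
have qd : q ^+ n.+1 <= d `^ alpha.
  by rewrite qE -powR_scale// ge0_ler_powR// ?(ltW alpha0)// nnegrE// ?invr_ge0 ?exprn_ge0 ?(ltW d0).
have Bd : B ^+ n.+1 * d <= B.
  have Bn : 0 < B ^+ n by rewrite exprn_gt0// ltr0n ltnW.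
  rewrite exprS -mulrA ler_piMr// mulrC -ler_pdivlMr// mul1r.
  exact: ltW.
rewrite (lacunary_expand _ q0 q1 SM n.+1 x) (lacunary_expand _ q0 q1 SM n.+1 y).
rewrite opprD addrACA -mulrBr (le_trans (ler_normD _ _))//.
rewrite [leRHS]mulrDl [leRHS](_ : _ = (L / (q * B - 1) * B) * d `^ alpha + 2 * (M / (1 - q)) * d `^ alpha + d `^ alpha); last first.
  by rewrite mul1r mulrDl.
rewrite -[leLHS]addr0 lerD ?powR_ge0// lerD//.
  rewrite (le_trans (partial_sum_increment_le _ _ _))//.
  rewrite -[leRHS]mulrA ler_wpM2l// (mulrC B).
  by apply: ler_pM; rewrite ?mulr_ge0 ?exprn_ge0 ?(ltW q0).
rewrite normrM (ger0_norm (exprn_ge0 _ (ltW q0))) [leLHS]mulrC.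
by apply: ler_pM; rewrite ?exprn_ge0 ?(ltW q0) ?osc.
Qed.

Hypothesis SD1 : forall z, S (z + 1) = S z.

Hypotheses (b8 : (8 %| b)%N) (qbL : 1 + L <= q * B).
Hypothesis sep : forall y, exists u v : R, [/\ 9 / 16 <= u, u <= v, v <= 7 / 8,
    exists j : nat, 8 * (v - u) = j%:R &
    2 <= `|symdiff S y v - symdiff S y u|].

(** Between the two steps supplied by [sep] at $y = B^n x$, scaled by $B^{-n}$,
the symmetric difference changes by at least $2q^n$ through the term $n$, by at
most $q^n$ through the lower terms, and not at all through the higher ones. So
at one of them it is at least $q^n/2$. *)
Lemma symdiff_large_at_scale (n : nat) (x : R) : exists h : R,
  [/\ 9 / 16 * B ^- n <= h, h <= 7 / 8 * B ^- n &
      q ^+ n / 2 <= `|symdiff f x h|].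
Proof.
have B0 : 0 < B.
  exact: lt_trans B1.
have Bn0 : 0 < B ^+ n by rewrite exprn_gt0.
have [u [v [u1 uv v1 [j uvj] far]]] := sep (B ^+ n * x).
have scaled w : B ^+ n * (w * B ^- n) = w by rewrite mulrCA mulfV ?mulr1// gt_eqF.
suff D : q ^+ n <= `|symdiff f x (v * B ^- n) - symdiff f x (u * B ^- n)|.
  have [hu|hu] := leP (q ^+ n / 2) `|symdiff f x (u * B ^- n)|.
    exists (u * B ^- n); split => //.
      by rewrite ler_pM2r// invr_gt0.
    by rewrite ler_pM2r ?invr_gt0// (le_trans uv).
  exists (v * B ^- n); split => //.
  - by rewrite ler_pM2r ?invr_gt0// (le_trans _ uv).
  - by rewrite ler_pM2r ?invr_gt0.
  - have := le_trans D (ler_normB _ _); lra.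
have [c bE] := dvdnP b8.
pose P z := \sum_(k < n) q ^+ k * S (B ^+ k * z).
have fE z : f z = P z + q ^+ n * S (B ^+ n * z) + q ^+ n.+1 * f (B ^+ n.+1 * z).
  by rewrite (lacunary_expand _ q0 q1 SM n.+1 z) big_ord_recr.
have fper z (i : nat) : f (z + i%:R) = f z.
  exact: periodicn (fun z => lacunaryD1 q b z SD1) i z.
have shift : B * (v - u) = (c * j)%:R.
  by rewrite bE !natrM -mulrA uvj.
(* The arguments of the tail differ by the integer c * j at the two steps. *)
have tail1 : f (B ^+ n.+1 * (x + v * B ^- n)) = f (B ^+ n.+1 * (x + u * B ^- n)).
  rewrite -(fper (B ^+ n.+1 * (x + u * B ^- n)) (c * j)%N) -shift; congr f.
  rewrite !mulrDr exprS -!(mulrA B) !scaled; ring.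
have tail2 : f (B ^+ n.+1 * (x - v * B ^- n)) = f (B ^+ n.+1 * (x - u * B ^- n)).
  rewrite -(fper (B ^+ n.+1 * (x - v * B ^- n)) (c * j)%N) -shift; congr f.
  rewrite !mulrBr exprS -!(mulrA B) !scaled; ring.
have -> : symdiff f x (v * B ^- n) - symdiff f x (u * B ^- n) =
  q ^+ n * (symdiff S (B ^+ n * x) v - symdiff S (B ^+ n * x) u)
  + ((P (x + v * B ^- n) - P (x + u * B ^- n))
     - (P (x - v * B ^- n) - P (x - u * B ^- n))).
  rewrite /symdiff (fE (x + v * _)) (fE (x - v * _)) (fE (x + u * _)).
  rewrite (fE (x - u * _)) tail1 tail2.
  rewrite !(mulrBr (B ^+ n)) !(mulrDr (B ^+ n)) !scaled.
  ring.
have qn0 : 0 < q ^+ n by rewrite exprn_gt0.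
have low (y z : R) : `|y - z| = (v - u) * B ^- n -> `|P y - P z| <= q ^+ n / 2.
  move=> yz; rewrite (le_trans (partial_sum_increment_le _ _ _))// yz scaled.
  rewrite mulrCA ler_wpM2l ?(ltW qn0)//.
  apply: (@le_trans _ _ (1 * (1 / 2))); last lra.
  rewrite ler_pM//; [|lra| |lra].
    by rewrite divr_ge0// subr_ge0 ltW.
  by rewrite ler_pdivrMr ?subr_gt0// mul1r lerBrDl.
have vuB : 0 <= (v - u) * B ^- n by rewrite mulr_ge0 ?subr_ge0// invr_ge0 ltW.
have low1 : `|P (x + v * B ^- n) - P (x + u * B ^- n)| <= q ^+ n / 2.
  apply: low; rewrite -[RHS]ger0_norm//; congr `|_|; ring.
have low2 : `|P (x - v * B ^- n) - P (x - u * B ^- n)| <= q ^+ n / 2.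
  apply: low; rewrite distrC -[RHS]ger0_norm//; congr `|_|; ring.
set X := _ - _ in far *; set E1 := _ - _ in low1 *; set E2 := _ - _ in low2 *.
have : q ^+ n * 2 <= `|q ^+ n * X| by rewrite normrM gtr0_norm// ler_pM2l.
have : `|E1 - E2| <= q ^+ n.
  by rewrite (le_trans (ler_normB _ _))// [leRHS]splitr lerD.
have := lerB_normD (q ^+ n * X) (E1 - E2).
lra.
Qed.

End increments.

(** * Integrals gathering one contribution per scale *)

Lemma continuous_symdiff_kernel (R : realType) (f : R -> R) (alpha x h : R) :
  continuous f -> 0 < h ->
  {for h, continuous (fun t => `|f (x + t) - f (x - t)| / t `^ alpha / t)}.
Proof.
move=> cf h0.
have cpow : {for h, continuous (fun t : R => t `^ alpha)}.
  by apply/differentiable_continuous/derivable1_diffP; case: (is_derive1_powR alpha h0).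
have cplus : {for h, continuous (fun t => f (x + t))}.
  apply: continuous_comp; last exact: cf.
  by apply: cvgD; [exact: cvg_cst|exact: cvg_id].
have cminus : {for h, continuous (fun t => f (x - t))}.
  apply: continuous_comp; last exact: cf.
  by apply: cvgB; [exact: cvg_cst|exact: cvg_id].
apply: cvgM; last by apply: cvgV; [rewrite gt_eqF|exact: cvg_id].
apply: cvgM; last by apply: cvgV; [rewrite gt_eqF// powR_gt0|exact: cpow].
by apply: cvg_norm; apply: cvgB.
Qed.

Lemma Lambda_continuous (R : realType) (f : R -> R) (alpha : R) :
  0 < alpha -> Lambda alpha f -> continuous f.
Proof.
move=> a0 [C [C0 fC]] x; apply/cvgrPdist_le => e e0.
near=> y.
rewrite (le_trans (fC _ _))// mulrC -ler_pdivlMr//.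
have -> : e / C = ((e / C) `^ alpha^-1) `^ alpha.
  by rewrite -powRrM mulVf ?gt_eqF// powRr1// divr_ge0// ltW.
rewrite ge0_ler_powR ?nnegrE ?(ltW a0) ?powR_ge0//.
near: y.
apply: cvgr_dist_le; first exact: cvg_id.
by rewrite powR_gt0// divr_gt0.
Unshelve. all: by end_near. Qed.

Lemma integrable_pos_itv (R : realType) (phi : R -> R) (a b : R) :
  (forall t : R, 0 < t -> {for t, continuous phi}) -> 0 < a ->
  (@lebesgue_measure R).-integrable `[a, b] (EFin \o phi).
Proof.
move=> phic a0; apply: continuous_compact_integrable.
  exact: segment_compact.
apply: continuous_in_subspaceT => t; rewrite inE/= in_itv/= => /andP[at_ _].
by apply: phic; exact: lt_le_trans at_.
Qed.

(** The bump at scale $k$ has mass at least $A\delta$ and lies in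
$[B^{-k}/2, B^{-k}]$; these blocks are disjoint because $B > 2$, and those with
$k \le n$ lie in $[e, 1]$. The lower endpoint $e$ is universally quantified
so that the induction on $n$ can remove the block of the smallest scale. *)
Lemma multiscale_integral_ge (R : realType) (phi : R -> R) (B dlt A : R)
    (n : nat) (e : R) :
  2 < B -> 0 < dlt -> 0 <= A -> (forall t : R, 0 < t -> 0 <= phi t) ->
  (forall t : R, 0 < t -> {for t, continuous phi}) ->
  (forall k, exists h, [/\ B ^- k / 2 <= h, h + dlt * B ^- k <= B ^- k &
    forall t, h <= t <= h + dlt * B ^- k -> A * B ^+ k <= phi t]) ->
  0 < e -> e <= B ^- n / 2 ->
  ((n.+1%:R * (A * dlt))%:E <=
   \int[@lebesgue_measure R]_(t in `[e, 1%R]) (phi t)%:E)%E.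
Proof.
move=> B2 dlt0 A0 phi0 phic bumps e0 en.
have Bk0 k : 0 < B ^+ k by rewrite exprn_gt0// (lt_trans _ B2).
have iphi (a b : R) := @integrable_pos_itv _ _ a b phic.
have mphi (a b : R) (a0 : 0 < a) := measurable_int _ (iphi a b a0).
have bump k : exists h, [/\ B ^- k / 2 <= h, h + dlt * B ^- k <= B ^- k &
    ((A * dlt)%:E <= \int[@lebesgue_measure R]_(t in `[h, (h + dlt * B ^- k)%R]) (phi t)%:E)%E].
  have [h [h1 h2 hphi]] := bumps k; exists h; split => //.
  have h0 : 0 < h by rewrite (lt_le_trans _ h1)// divr_gt0// invr_gt0.
  have -> : ((A * dlt)%:E = \int[@lebesgue_measure R]_(t in `[h, (h + dlt * B ^- k)%R]) (cst (A * B ^+ k)%:E t))%E.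
    rewrite integral_cst//= lebesgue_measure_itv/= lte_fin ltrDl.
    rewrite mulr_gt0 ?invr_gt0// -EFinD -EFinM; congr (_%:E).
    rewrite addrAC subrr add0r mulrACA mulfV ?mulr1// gt_eqF//.
  apply: ge0_le_integral => //.
  - by move=> t _; rewrite lee_fin mulr_ge0// ltW.
  - exact: (mphi _ _ h0).
elim: n e e0 en => [|n IH] e e0 en.
  have [h [h1 h2 hphi]] := bump 0%N; rewrite mul1r; apply: le_trans hphi _.
  apply: ge0_subset_integral => //; first exact: (mphi _ _ e0).
    move=> t /=; rewrite in_itv/= => /andP[et _].
    by rewrite lee_fin phi0// (lt_le_trans e0).
  move=> t /=; rewrite !in_itv/= => /andP[ht th].
  rewrite (le_trans en)/= ?(le_trans h1)// (le_trans th)// (le_trans h2)//.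
  by rewrite expr0 invr1.
have en0 : 0 < B ^- n / 2 by rewrite divr_gt0// invr_gt0.
have := IH _ en0 (lexx _).
have [h [h1 h2 hphi]] := bump n.+1 => I1.
have half : B ^- n.+1 < B ^- n / 2.
  rewrite exprS invfM mulrC ltr_pM2l ?invr_gt0// ltf_pV2// posrE//.
  by rewrite (lt_trans _ B2).
have e1 : B ^- n / 2 <= 1.
  rewrite ler_pdivrMr// mul1r invf_ple ?posrE//.
  by rewrite (@le_trans _ _ 1) ?exprn_ege1 ?invf_le1 ?ler1n// ltW// (lt_trans _ B2) ?ltr1n.
have h0 : 0 < h.
  by rewrite (lt_le_trans _ h1)// divr_gt0// invr_gt0.
apply: (@le_trans _ _ (\int[@lebesgue_measure R]_(t in `[h, (h + dlt * B ^- n.+1)%R]%classic `|` `[(B ^- n / 2)%R, 1%R]%classic) (phi t)%:E)%E).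
  rewrite ge0_integral_setU//=.
  - rewrite -natr1 mulrDl mul1r addrC EFinD; exact: leeD.
  - apply/measurable_funU => //; split; [exact: (mphi _ _ h0)|exact: (mphi _ _ en0)].
  - move=> t [|]; rewrite /= in_itv/= lee_fin => /andP[t0 _]; apply: phi0.
      exact: lt_le_trans t0.
    exact: lt_le_trans t0.
  - apply/disj_setPS => t [] /=; rewrite !in_itv/= => /andP[_ t1] /andP[t2 _].
    have := lt_le_trans half t2; rewrite ltNge => /negP; apply.
    exact: le_trans h2.
apply: ge0_subset_integral => //.
- exact: measurableU.
- exact: (mphi _ _ e0).
- move=> t /=; rewrite in_itv/= => /andP[et _].
  by rewrite lee_fin phi0// (lt_le_trans e0).
- move=> t [|] /=; rewrite !in_itv/= => /andP[t1 t2].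
    rewrite (le_trans en)/= ?(le_trans h1)// (le_trans t2)// (le_trans h2)//.
    by rewrite (le_trans (ltW half)).
  rewrite t2 andbT (le_trans en)// (le_trans _ t1)//.
  have := ltW half; have : 0 < B ^- n.+1 by rewrite invr_gt0.
  lra.
Qed.

(** * The lower bound *)

Lemma powR_small (R : realType) (alpha eta : R) : 0 < alpha -> 0 < eta ->
  exists d : R, [/\ 0 < d, d <= 1 / 8 & d `^ alpha <= eta].
Proof.
move=> a0 eta0; exists (Num.min (1 / 8) (eta `^ alpha^-1)); split.
- by rewrite lt_min powR_gt0// divr_gt0.
- by rewrite ge_min lexx.
- rewrite -[leRHS](_ : (eta `^ alpha^-1) `^ alpha = _); last first.
    by rewrite -powRrM mulVf ?gt_eqF// powRr1// ltW.
  rewrite ge0_ler_powR ?nnegrE ?(ltW a0) ?powR_ge0//.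
    by rewrite le_min powR_ge0 divr_ge0.
  by rewrite ge_min lexx orbT.
Qed.

(** By the Hoelder bound, moving the step from $h$ by at most $d B^{-k}$
changes the symmetric difference by at most
$2 C d^\alpha q^k \le q^k/4$, with $q = B^{-\alpha}$, so at least half of
its size $q^k/2$ survives. The weight $t^{-\alpha-1}$ is at least
$q^{-k} B^k$ for $t \le B^{-k}$. *)
Lemma kernel_bump (R : realType) (f : R -> R) (alpha C B x h d : R) (k : nat) :
  0 < alpha -> 0 < B -> 0 < C ->
  (forall y z, `|f y - f z| <= C * `|y - z| `^ alpha) ->
  0 < h -> 0 < d -> 8 * C * d `^ alpha <= 1 ->
  h + d * B ^- k <= B ^- k ->
  (B `^ (- alpha)) ^+ k / 2 <= `|symdiff f x h| ->
  forall t, h <= t <= h + d * B ^- k ->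
    1 / 4 * B ^+ k <= `|f (x + t) - f (x - t)| / t `^ alpha / t.
Proof.
move=> a0 B0 C0 fC h0 d0 dC hB large t /andP[ht th].
have t0 : 0 < t by exact: lt_le_trans ht.
have tB : t <= B ^- k by exact: le_trans hB.
have Bk0 : 0 < B ^- k by rewrite invr_gt0 exprn_gt0.
have qk := powR_scale alpha k (ltW B0).
set qk' := (B `^ (- alpha)) ^+ k in qk large *.
have inc : `|t - h| `^ alpha <= d `^ alpha * qk'.
  rewrite -qk -powRM ?(ltW d0) ?(ltW Bk0)//.
  rewrite ge0_ler_powR ?nnegrE ?(ltW a0) ?mulr_ge0 ?(ltW d0) ?(ltW Bk0)//.
  by rewrite ger0_norm ?subr_ge0// lerBlDl.
have e1 : `|f (x + t) - f (x + h)| <= C * (d `^ alpha * qk').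
  rewrite (le_trans (fC _ _))// ler_pM2l//; apply: le_trans inc.
  by rewrite opprD addrACA subrr add0r.
have e2 : `|f (x - t) - f (x - h)| <= C * (d `^ alpha * qk').
  rewrite (le_trans (fC _ _))// ler_pM2l//; apply: le_trans inc.
  by rewrite opprD addrACA subrr add0r -opprD normrN.
have qk0 : 0 < qk' by rewrite -qk powR_gt0.
have e3 : C * (d `^ alpha * qk') <= qk' / 8.
  rewrite mulrA (_ : C * d `^ alpha * qk' = (8 * C * d `^ alpha) * (qk' / 8)); last by field.
  by rewrite ler_piMl// divr_ge0// ltW.
have F : qk' / 4 <= `|f (x + t) - f (x - t)|.
  have -> : f (x + t) - f (x - t) =
    symdiff f x h + ((f (x + t) - f (x + h)) - (f (x - t) - f (x - h))).
    by rewrite /symdiff; ring.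
  have := lerB_normD (symdiff f x h) ((f (x + t) - f (x + h)) - (f (x - t) - f (x - h))).
  have := ler_normB (f (x + t) - f (x + h)) (f (x - t) - f (x - h)).
  lra.
have ta : t `^ alpha <= qk'.
  by rewrite -qk ge0_ler_powR ?nnegrE ?(ltW a0) ?(ltW t0) ?(ltW Bk0).
rewrite !ler_pdivlMr ?powR_gt0//; apply: le_trans F.
have : (B ^+ k * t) * t `^ alpha <= 1 * qk'.
  apply: ler_pM => //; rewrite ?powR_ge0 ?mulr_ge0 ?(ltW t0) ?exprn_ge0 ?(ltW B0)//.
  by rewrite mulrC -ler_pdivlMr ?exprn_gt0// mul1r.
lra.
Qed.

(** $b^{-\alpha} b = b^{1-\alpha}$ is unbounded because $\alpha < 1$. *)
Lemma large_base (R : realType) (alpha K : R) : alpha < 1 ->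
  exists b : nat, [/\ (8 %| b)%N, (0 < b)%N &
    K <= (b%:R : R) `^ (- alpha) * b%:R].
Proof.
move=> a1; have s0 : 0 < 1 - alpha by rewrite subr_gt0.
pose w := `|K| `^ (1 - alpha)^-1.
exists (8 * (Num.truncn w).+1)%N; split => //; first exact: dvdn_mulr.
set b := (8 * _)%N.
have wb : w <= (b%:R : R).
  rewrite (le_trans (ltW (truncnS_gt _)))// ler_nat leq_pmull//.
rewrite (le_trans (ler_norm _))//.
have -> : `|K| = w `^ (1 - alpha).
  by rewrite -powRrM mulVf ?gt_eqF// powRr1.
rewrite -[X in _ * X](@powRr1 R b%:R)// -powRD; last first.
  by apply/implyP => _; rewrite pnatr_eq0.
by rewrite (addrC _ 1) ge0_ler_powR ?nnegrE ?(ltW s0) ?powR_ge0.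
Qed.

Theorem mainTheorem3 (R : realType) (alpha : R)
    (alpha_gt0 : 0 < alpha) (alpha_lt1 : alpha < 1) :
  exists f : R -> R, Lambda alpha f /\
  exists c : R, 0 < c /\
  forall eps : R, 0 < eps -> eps < 1 / 2 ->
  {ae (@lebesgue_measure R), forall x : R,
    c * ln (1 / eps) <
    \int[@lebesgue_measure R]_(h in `[eps, 1])
      (`|f (x + h) - f (x - h)| / h `^ alpha / h)}.
Proof.
have L0 : 0 < 12 * pi :> R by rewrite mulr_gt0// pi_gt0.
have [b [b8 b0 qbL]] := large_base (1 + 12 * pi) alpha_lt1.
set B := b%:R : R; set q := B `^ (- alpha).
have b8' : (8 <= b)%N by exact: dvdn_leq.
have B8 : 8 <= B by rewrite ler_nat.
have B0 : 0 < B by lra.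
have q0 : 0 < q by rewrite powR_gt0.
have qb : 1 < q * B by rewrite (lt_le_trans _ qbL)// ltrDl.
have q1 : q < 1.
  rewrite /q powRN invf_lt1 ?powR_gt0//.
  apply: (@le_lt_trans _ _ (1 `^ alpha)); first by rewrite powR1.
  by rewrite gt0_ltr_powR ?nnegrE//; lra.
pose f := lacunary (@profile R) q B.
have fL : Lambda alpha f.
  exact: (lacunary_Lambda q0 q1 qb (@profile_le2 R) (@profile_lipschitz R)).
exists f; split => //.
have fc : continuous f := Lambda_continuous alpha_gt0 fL.
have [C [C0 fC]] := fL.
have eta0 : 0 < (8 * C)^-1 by rewrite invr_gt0 mulr_gt0.
have [d [d0 d8 dC]] := powR_small alpha_gt0 eta0.
have lnB : 0 < ln B by apply: ln_gt0; lra.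
pose c0 : R := 1 / 4 * d.
have c00 : 0 < c0 by rewrite /c0; lra.
(* Each block gives c0, and n.+1 blocks correspond to ln (1 / eps) at most
   2 * n.+1 * ln B; the additional factor 2 makes the inequality strict. *)
exists (c0 / (4 * ln B)); split; first by rewrite divr_gt0// mulr_gt0.
move=> eps e0 e1; apply: aeW => x.
have [n /andP[n1 n2]] : exists n : nat, B ^- n.+1 <= 2 * eps < B ^- n.
  by apply: bracket_scale; [exact: leq_trans b8'|lra|lra].
pose phi t := `|f (x + t) - f (x - t)| / t `^ alpha / t.
have phic t : 0 < t -> {for t, continuous phi}.
  exact: continuous_symdiff_kernel.
have phi0 t : 0 < t -> 0 <= phi t.
  by move=> t0; rewrite !divr_ge0// ?powR_ge0// ltW.
have bumps k : exists h, [/\ B ^- k / 2 <= h, h + d * B ^- k <= B ^- k &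
    forall t, h <= t <= h + d * B ^- k -> 1 / 4 * B ^+ k <= phi t].
  have [h [h1 h2 large]] := symdiff_large_at_scale q0 q1 qb (@profile_le2 R)
    (@profile_lipschitz R) (@profileD1 R) b8 qbL (@profile_separation R) k x.
  have Bk : 0 < B ^- k by rewrite invr_gt0 exprn_gt0.
  rewrite -/B in h1 h2 large.
  have hB : h + d * B ^- k <= B ^- k.
    have := ler_wpM2r (ltW Bk) d8; lra.
  exists h; split => //; first lra.
  apply: (kernel_bump alpha_gt0 B0 C0 fC _ d0 _ hB large); first lra.
  have C8 : 0 < 8 * C by lra.
  by rewrite -[leRHS](mulfV (lt0r_neq0 C8)) ler_pM2l.
have en : eps <= B ^- n / 2 by lra.
have B2 : 2 < B by lra.
have A0 : 0 <= 1 / 4 :> R by lra.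
have := multiscale_integral_ge B2 d0 A0 phi0 phic bumps e0 en.
rewrite -/c0 -[X in (_ <= X)%E]fineK; last first.
  by apply: integrable_fin_num => //; exact: integrable_pos_itv.
rewrite lee_fin => int_ge; apply: (lt_le_trans _ int_ge).
(* By the choice of n, 1 / eps <= 2 * B ^+ n.+1 <= B ^+ (2 * n.+1). *)
have ln_le : ln (1 / eps) <= 2 * n.+1%:R * ln B.
  have : ln (1 / eps) <= ln (B ^+ (2 * n.+1)).
    rewrite ler_ln ?posrE ?divr_gt0 ?exprn_gt0//.
    rewrite ler_pdivrMr// mulnC exprM.
    have BN : B <= B ^+ n.+1 by rewrite ler_eXnr//; lra.
    have : 1 <= 2 * eps * B ^+ n.+1.
      by rewrite -ler_pdivrMr ?exprn_gt0// mul1r.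
    nra.
  by rewrite lnXn// -[ln B *+ _]mulr_natl natrM.
have n0 : 0 < n.+1%:R :> R by [].
rewrite (le_lt_trans (ler_wpM2l _ ln_le))//.
  by rewrite divr_ge0 ?mulr_ge0 ?ltW.
have -> : c0 / (4 * ln B) * (2 * n.+1%:R * ln B) = n.+1%:R * c0 / 2.
  by field; rewrite gt_eqF.
have : 0 < n.+1%:R * c0 by rewrite mulr_gt0.
lra.
Qed.
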